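(* Let $E$ be a Banach space, $G\subset E$ compact, and $\lambda>1$. Let $X:=\ell_\infty(E)=\{x=(x_1,x_2,\dots):x_j\in E,\ \sup_{j\ge1}\|x_j\|_E<\infty\}$ with the metric $d_X(x,y):=\sup_{j\ge1}\min\{1,\|x_j-y_j\|_E\}$, and let $d_\infty$ be the induced uniform metric on $C(X,X)$. Define $r(x):=0$, $A(x_1,x_2,\dots):=(\lambda x_1,\lambda x_2,\dots)$, and for $u\in G$, $g_u(x_1,x_2,\dots):=(u,x_1,x_2,\dots)$. Let $F:=\{r,A\}\cup\{g_u:u\in G\}$. For $k\ge1$ and $u=(u_1,\dots,u_k)\in G^k$ define $$w_u:=A\circ g_{u_k}\circ A\circ g_{u_{k-1}}\circ\cdots\circ A\circ g_{u_1}\circ r,\qquad W_k:=\{w_u:u\in G^k\}\subset B(2k+1,F).$$ Then: (i) For every $x\in X$, $w_u(x)=(\lambda u_k,\lambda^2u_{k-1},\dots,\lambda^ku_1,0,0,\dots)$; in particular each $w_u$ is a constant map. (ii) For $u,v\in G^k$, $d_\infty(w_u,w_v)=\max_{1\le j\le k}\min\{1,\lambda^{k-j+1}\|u_j-v_j\|_E\}$. (iii) For every $0<\varepsilon<1/2$, $$\prod_{j=1}^kM\Big(G,\|\cdot\|_E,\frac{2\varepsilon}{\lambda^{k-j+1}}\Big)\le N(W_k,d_\infty,\varepsilon)\le\prod_{j=1}^kN\Big(G,\|\cdot\|_E,\frac{\varepsilon}{\lambda^{k-j+1}}\Big).$$ Consequently, $N(B(2k+1,F),d_\infty,\varepsilon)\ge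 N(W_k,d_\infty,\varepsilon)$.
   Context: $C(X,X)$ is the set of continuous self-maps of $(X,d_X)$ and $d_\infty(f,g)=\sup_{x\in X}d_X(f(x),g(x))$. $B(m,F)$ is the set of all compositions of at most $m$ maps from $F$ (including the identity). $N(A,\rho,\varepsilon)$ is the covering number: the least number of open $\rho$-balls of radius $\varepsilon$, with centers in the ambient metric space ($E$ or $C(X,X)$), covering $A$. $M(A,\rho,\varepsilon)$ is the packing number: the maximal cardinality of a subset of $A$ whose distinct points have $\rho$-distance $\ge\varepsilon$. *)

(* Defs.v *)
From HB Require Import structures.
From mathcomp Require Import all_boot all_order all_algebra.
From mathcomp Require Import all_classical all_reals all_analysis.
From mathcomp Require Import lra.
Set Implicit Arguments.
Unset Strict Implicit.
Unset Printing Implicit Defensive.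
Import Order.TTheory GRing.Theory Num.Theory.
Import numFieldNormedType.Exports.
Local Open Scope classical_set_scope.
Local Open Scope ring_scope.

Section Covering.
Context {R : realType} {T : Type}.
Implicit Types (A C : set T) (rho : T -> T -> R) (eps : R).

(* [A] is covered by [n] open balls of radius [eps] centred in the ambient
   set [C]. *)
Definition covered_by C rho eps A (n : nat) : Prop :=
  exists S : set T, [/\ S `<=` C, (S #= `I_n)%card &
    A `<=` \bigcup_(c in S) [set y | rho c y < eps]].

(* Values are extended reals, so that no finiteness has to be assumed: the
   infimum is attained if there is a finite cover and is +oo otherwise. *)
Definition covering_number C rho eps A : \bar R :=
  ereal_inf [set (n%:R)%:E | n in covered_by C rho eps A].

Definition has_packing rho eps A (n : nat) : Prop :=
  exists S : set T, [/\ S `<=` A, (S #= `I_n)%card &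
    forall x y, S x -> S y -> x <> y -> eps <= rho x y].

(* The supremum is a maximum, or +oo if there are arbitrarily large finite
   packings. *)
Definition packing_number rho eps A : \bar R :=
  ereal_sup [set (n%:R)%:E | n in has_packing rho eps A].

(* Compositions h_0 \o ... \o h_(n-1) of n <= m elements of F; n = 0 gives
   the identity. *)
Definition compositions (m : nat) (F : set (T -> T)) : set (T -> T) :=
  [set f | exists n (h : 'I_n -> T -> T),
    [/\ (n <= m)%N, forall i, F (h i) & f = \big[comp/id]_(i < n) h i]].

End Covering.

Definition norm_dist {R : realType} {E : normedModType R} (x y : E) : R :=
  `|x - y|.

(* [x n] is the entry with index n + 1 of a bounded sequence. *)
Record linf (R : realType) (E : normedModType R) := Linf {
  linf_seq :> nat -> E;
  linf_bounded : has_ubound (range (fun j => `|linf_seq j|)) }.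

HB.instance Definition _ (R : realType) (E : normedModType R) :=
  gen_eqMixin (linf E).
HB.instance Definition _ (R : realType) (E : normedModType R) :=
  gen_choiceMixin (linf E).

Section LinfMetric.
Context {R : realType} {E : normedModType R}.
Implicit Types x y z : linf E.

Definition linf_dist x y : R :=
  sup (range (fun j => Num.min 1 `|x j - y j|)).

Lemma linf_eqP x y : (forall j, x j = y j) -> x = y.
Proof.
case: x y => [x hx] [y hy] /= /funext xy.
by case: _ / xy hy => hy; congr Linf; exact: Prop_irrelevance.
Qed.

Lemma linf_dist_ub x y j : Num.min 1 `|x j - y j| <= linf_dist x y.
Proof.
apply: ub_le_sup; last by exists j.
by exists 1 => _ [i _ <-]; rewrite ge_min lexx.
Qed.

Lemma linf_dist_le x y (a : R) :
  (forall j, Num.min 1 `|x j - y j| <= a) -> linf_dist x y <= a.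
Proof.
move=> h; apply: ge_sup; first by exists (Num.min 1 `|x 0%N - y 0%N|), 0%N.
by move=> _ [i _ <-].
Qed.

Lemma linf_distxx x : linf_dist x x = 0.
Proof.
apply/eqP; rewrite eq_le; apply/andP; split.
  by apply: linf_dist_le => j; rewrite subrr normr0 ge_min lexx orbT.
by apply: le_trans (linf_dist_ub x x 0); rewrite le_min ler01 normr_ge0.
Qed.

Lemma linf_dist_positivity x y : linf_dist x y = 0 -> x = y.
Proof.
move=> xy0; apply: linf_eqP => j.
have := linf_dist_ub x y j; rewrite xy0 ge_min ler10 /= normr_le0 subr_eq0.
by move/eqP.
Qed.

Lemma linf_dist_sym x y : linf_dist x y = linf_dist y x.
Proof.
rewrite /linf_dist; suff -> : (fun j => Num.min 1 `|x j - y j|) =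
  (fun j => Num.min 1 `|y j - x j|) by [].
by apply/funext => j; rewrite distrC.
Qed.

Lemma linf_dist_triangle y x z :
  linf_dist x z <= linf_dist x y + linf_dist y z.
Proof.
apply: linf_dist_le => j.
apply: le_trans (lerD (linf_dist_ub x y j) (linf_dist_ub y z j)).
have := ler_distD (y j) (x j) (z j).
have := normr_ge0 (x j - y j); have := normr_ge0 (y j - z j).
rewrite /Num.min; case: ltP => ?; case: ltP => ?; case: ltP => ?; lra.
Qed.

HB.instance Definition _ := isMetric.Build R (linf E)
  linf_distxx linf_dist_positivity linf_dist_sym linf_dist_triangle.

End LinfMetric.

Definition cmaps (R : realType) (X : metricType R) : set (X -> X) :=
  [set f | continuous f].
Arguments cmaps {R} X _.

(* A supremum of reals: meaningful as soon as the distance of X is bounded,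
   as is the case for [linf_dist]. *)
Definition dinfty {R : realType} {X : metricType R} (f g : X -> X) : R :=
  sup (range (fun x => mdist (f x) (g x))).

Section Maps.
Context {R : realType} {E : normedModType R}.
Implicit Types (x : linf E) (lam : R) (u : E).

Lemma zero_bounded : has_ubound (range (fun j : nat => `|(0 : E)|)).
Proof. by exists 0 => _ [j _ <-]; rewrite normr0. Qed.

Definition zero_map x : linf E := Linf zero_bounded.

Lemma scale_bounded lam x : has_ubound (range (fun j => `|lam *: x j|)).
Proof.
have [M hM] := linf_bounded x; exists (`|lam| * M) => _ [j _ <-].
by rewrite normrZ ler_wpM2l//; apply: hM; exists j.
Qed.

Definition scale_map lam x : linf E := Linf (scale_bounded lam x).

Definition shift_seq u x (n : nat) : E := if n is m.+1 then x m else u.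

Lemma shift_bounded u x : has_ubound (range (fun j => `|shift_seq u x j|)).
Proof.
have [M hM] := linf_bounded x; exists (Num.max `|u| M) => _ [[|j] _ <-] /=.
  by rewrite le_max lexx.
by rewrite le_max (hM `|x j|) ?orbT//; exists j.
Qed.

Definition shift_map u x : linf E := Linf (shift_bounded u x).

Definition Fmaps lam (G : set E) : set (linf E -> linf E) :=
  [set zero_map] `|` [set scale_map lam] `|` [set shift_map u | u in G].

(* The leftmost factor of the composition uses the last entry of u. *)
Definition word lam (k : nat) (u : 'I_k -> E) : linf E -> linf E :=
  foldl (fun f a => scale_map lam \o shift_map a \o f) zero_map (codom u).

Definition words lam (G : set E) (k : nat) : set (linf E -> linf E) :=
  [set word lam u | u in [set u : 'I_k -> E | forall j, G (u j)]].

End Maps.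

(* Main.v *)
Require Import Defs.
From HB Require Import structures.
From mathcomp Require Import all_boot all_order all_algebra.
From mathcomp Require Import all_classical all_reals all_analysis.
Import Order.TTheory GRing.Theory Num.Theory.
Import numFieldNormedType.Exports.
Local Open Scope classical_set_scope.
Local Open Scope ring_scope.

(** Each word is a constant map, and applying [scale_map lam \o shift_map a]
    multiplies the earlier letters once more by [lam]; hence the uniform
    distance of two words is a maximum of truncated norms in which each letter
    appears with its own scale. Words then behave like points of a product
    space with a max metric: products of packings of G at the rescaled radii
    are packings of the words (truncation at 1 is harmless as 2 eps < 1), and
    products of covers are covers. Compactness makes all the covering and
    packing numbers of G finite, hence attained. *)

(** * Counting with finite index types *)

Lemma card_eq_I_range (T : Type) (S : set T) (n : nat) :
  (S #= `I_n)%card -> exists2 c : 'I_n -> T, injective c & S = range c.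
Proof.
move=> /card_set_bijP[f [fS finj fsurj]].
have /choice[c hc] (i : 'I_n) : exists x, S x /\ f x = i.
  by have [x Sx <-] := fsurj i (ltn_ord i); exists x.
exists c.
  by move=> i j cij; apply: val_inj; rewrite /= -(hc i).2 -(hc j).2 cij.
apply/seteqP; split=> [x Sx|_ [i _ <-]]; last exact: (hc i).1.
exists (Ordinal (fS x Sx)) => //.
apply: finj; rewrite ?inE//; first exact: (hc _).1.
by rewrite (hc _).2.
Qed.

(** A dependent function picks one index in each coordinate, so a product of covering or packing
    numbers becomes the cardinality of a single finite type. *)
Lemma card_dffun_ord (I : finType) (n : I -> nat) :
  #|{dffun forall i : I, 'I_(n i)}| = (\prod_i n i)%N.
Proof.
rewrite card_dep_ffun foldrE big_map big_enum.
by apply: eq_bigr => i _; rewrite card_ord.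
Qed.

(** * Covering and packing numbers for an arbitrary distance function *)

Section CoveringPacking.
Context {R : realType} {T : Type}.
Implicit Types (A C : set T) (rho : T -> T -> R) (eps : R).

(* Unqualified, [covered_by] is a different notion of MathComp-Analysis. *)
Lemma covered_by_centers C rho eps A (n : nat) : Defs.covered_by C rho eps A n ->
  exists c : 'I_n -> T, (forall j, C (c j)) /\
    forall x, A x -> exists j, rho (c j) x < eps.
Proof.
move=> [S [SC /card_eq_I_range[c _ Sc] AS]]; exists c; split=> [j|x Ax].
  by apply: SC; rewrite Sc; exists j.
by have [y] := AS x Ax; rewrite Sc => -[j _ <-]; exists j.
Qed.

Lemma has_packing_centers rho eps A (n : nat) : has_packing rho eps A n ->
  exists p : 'I_n -> T, (forall i, A (p i)) /\
    forall i j, i <> j -> eps <= rho (p i) (p j).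
Proof.
move=> [S [SA /card_eq_I_range[p pinj Sp] hS]]; exists p; split=> [i|i j ij].
  by apply: SA; rewrite Sp; exists i.
by apply: hS; rewrite ?Sp; [exists i|exists j|move/pinj].
Qed.

(** The family [c] may repeat centers, so its range can have fewer than [#|J|] elements; its exact
    cardinality [n] still bounds the covering number from above. *)
Lemma covering_number_le_card C rho eps A (J : finType) (c : J -> T) :
  (forall j, C (c j)) -> (forall x, A x -> exists j, rho (c j) x < eps) ->
  (covering_number C rho eps A <= (#|J|%:R)%:E)%E.
Proof.
move=> cC Ac.
have JI : (range c #<= `I_#|J|)%card.
  rewrite (card_le_eqr card_II).
  apply: card_le_trans (card_image_le (c \o enum_val) setT).
  apply: subset_card_le => _ [j _ <-].
  by exists (enum_rank j) => //=; rewrite enum_rankK.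
have [n cn] : finite_set (range c) by exact: finite_image.
apply: (@le_trans _ _ (n%:R)%:E).
  apply: ereal_inf_lbound; exists n => //; exists (range c); split=> //.
    by move=> _ [j _ <-].
  by move=> x /Ac[j ?]; exists (c j) => //; exists j.
by rewrite lee_fin ler_nat -card_le_II -(card_le_eql cn).
Qed.

Lemma ge_covering_number C rho eps A (a : \bar R) :
  (forall n, Defs.covered_by C rho eps A n -> (a <= (n%:R)%:E)%E) ->
  (a <= covering_number C rho eps A)%E.
Proof. by move=> h; apply: le_ereal_inf_tmp => _ [n hn <-]; exact: h. Qed.

(** One finite cover suffices: the infimum then runs over a nonempty set of naturals, which has a
    least element. *)
Lemma covering_number_attained C rho eps A (m : nat) :
  Defs.covered_by C rho eps A m -> exists2 n, Defs.covered_by C rho eps A n &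
    covering_number C rho eps A = (n%:R)%:E.
Proof.
move=> hm.
have ex : exists n, `[< Defs.covered_by C rho eps A n >] by exists m; exact/asboolP.
case: (ex_minnP ex) => n /asboolP hn nmin; exists n => //.
apply/eqP; rewrite eq_le; apply/andP; split.
  by apply: ereal_inf_lbound; exists n.
by apply: ge_covering_number => p /asboolP/nmin; rewrite lee_fin ler_nat.
Qed.

Lemma packing_number_attained rho eps A (m : nat) :
  (forall n, has_packing rho eps A n -> (n <= m)%N) ->
  exists2 n, has_packing rho eps A n & packing_number rho eps A = (n%:R)%:E.
Proof.
move=> hm.
have ex : exists n, `[< has_packing rho eps A n >].
  (* The empty packing makes the set of sizes nonempty, so that the bounded set has a maximum. *)
  by exists 0%N; apply/asboolP; exists set0; split => //; rewrite II0.
have ub n : `[< has_packing rho eps A n >] -> (n <= m)%N by move/asboolP/hm.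
case: (ex_maxnP ex ub) => n /asboolP hn nmax; exists n => //.
apply/eqP; rewrite eq_le; apply/andP; split.
  by apply: ge_ereal_sup => _ [p /asboolP/nmax pn <-]; rewrite lee_fin ler_nat.
by apply: ereal_sup_ubound; exists n.
Qed.

Lemma le_covering_number C rho eps A B : A `<=` B ->
  (covering_number C rho eps A <= covering_number C rho eps B)%E.
Proof.
move=> AB; apply: ge_covering_number => n [S [SC Sn BS]].
by apply: ereal_inf_lbound; exists n => //; exists S; split=> // x /AB/BS.
Qed.

(* A ball of radius [eps] contains at most one of the points [p i]. *)
Lemma card_separated_le rho eps (I J : finType) (p : I -> T) (c : J -> T) :
  (forall x y, rho x y = rho y x) ->
  (forall y x z, rho x z <= rho x y + rho y z) ->
  (forall i i', i <> i' -> 2 * eps <= rho (p i) (p i')) ->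
  (forall i, exists j, rho (c j) (p i) < eps) -> (#|I| <= #|J|)%N.
Proof.
move=> sym tri sep /choice[f hf]; apply: (@leq_card _ _ f) => i i' fii'.
apply: contrapT => /sep; apply/negP; rewrite -ltNge.
apply: le_lt_trans (tri (c (f i)) _ _) _.
by rewrite mulr_natl mulr2n ltrD// ?fii' ?hf// sym -fii' hf.
Qed.

Lemma packing_le_covering C rho eps A (m n : nat) :
  (forall x y, rho x y = rho y x) ->
  (forall y x z, rho x z <= rho x y + rho y z) ->
  has_packing rho (2 * eps) A m -> Defs.covered_by C rho eps A n -> (m <= n)%N.
Proof.
move=> sym tri /has_packing_centers[p [pA sep]] /covered_by_centers[c [_ Ac]].
rewrite -[m]card_ord -[n]card_ord.
by apply: (@card_separated_le rho eps _ _ p c) => // i; apply: Ac.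
Qed.

End CoveringPacking.

(** * The norm distance and finite covers of compact sets *)

Section NormDist.
Context {R : realType} {E : normedModType R}.

Lemma norm_dist_sym (x y : E) : norm_dist x y = norm_dist y x.
Proof. exact: distrC. Qed.

Lemma norm_dist_triangle (y x z : E) :
  norm_dist x z <= norm_dist x y + norm_dist y z.
Proof. exact: ler_distD. Qed.

Lemma compact_covered_by (G : set E) (eps : R) : compact G -> 0 < eps ->
  exists n, Defs.covered_by setT norm_dist eps G n.
Proof.
move=> cG e0; move: cG; rewrite compact_cover.
move=> /(_ E G (fun x => ball x eps)).
case=> [x _|x Gx|D _ GD]; first exact: ball_open.
  by exists x => //; exact: ballxx.
have [n Dn] := finite_fset D.
exists n; apply: (ex_intro _ _ (And3 _ Dn _)) => // x /GD[y Dy].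
by rewrite -ball_normE/= => yx; exists y.
Qed.

End NormDist.

(** * The uniform distance, and continuity of the maps in [Fmaps] *)

Section UniformDistance.
Context {R : realType} {E : normedModType R}.
Implicit Types (f g h : linf E -> linf E) (c x : linf E).

Lemma linf_dist_le1 x c : linf_dist x c <= 1.
Proof. by apply: linf_dist_le => j; rewrite ge_min lexx. Qed.

Lemma dinfty_ub f g x : linf_dist (f x) (g x) <= dinfty f g.
Proof.
apply: ub_le_sup; last by exists x.
by exists 1 => _ [y _ <-]; exact: linf_dist_le1.
Qed.

Lemma dinfty_le f g (a : R) :
  (forall x, linf_dist (f x) (g x) <= a) -> dinfty f g <= a.
Proof.
move=> h; apply: ge_sup => [|_ [y _ <-]]; last exact: h.
(* The zero sequence shows that the supremum is taken over a nonempty set. *)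
by pose z : linf E := Linf zero_bounded; exists (mdist (f z) (g z)), z.
Qed.

Lemma dinfty_sym f g : dinfty f g = dinfty g f.
Proof.
by apply/eqP; rewrite eq_le; apply/andP; split; apply: dinfty_le => x;
  rewrite linf_dist_sym dinfty_ub.
Qed.

Lemma dinfty_triangle g f h : dinfty f h <= dinfty f g + dinfty g h.
Proof.
apply: dinfty_le => x; apply: le_trans (linf_dist_triangle (g x) _ _) _.
by rewrite lerD ?dinfty_ub.
Qed.

Lemma lipschitz_cmaps f (M : R) : 0 < M ->
  (forall x y, linf_dist (f x) (f y) <= M * linf_dist x y) ->
  cmaps (linf E) f.
Proof.
move=> M0 fM x A /nbhs_ballP[e e0 eA].
apply/nbhs_ballP; exists (e / M) => [|y]; first exact: divr_gt0.
rewrite ballEmdist/= => xy; apply: eA; rewrite ballEmdist/=.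
by apply: le_lt_trans (fM _ _) _; rewrite mulrC -ltr_pdivlMr.
Qed.

Lemma cst_cmaps c : cmaps (linf E) (cst c).
Proof. exact: cst_continuous. Qed.

(** The truncated metric scales by at most [lam]: for [1 <= lam], [min 1 (lam * t) <= min lam (lam *
    t) = lam * min 1 t]. *)
Lemma scale_map_cmaps (lam : R) : 1 <= lam -> cmaps (linf E) (scale_map lam).
Proof.
move=> lam1; have lam0 := lt_le_trans ltr01 lam1.
apply: (@lipschitz_cmaps _ lam) => // x y.
apply: linf_dist_le => j /=.
apply: (@le_trans _ _ (lam * Num.min 1 `|x j - y j|)); last first.
  by rewrite ler_wpM2l ?linf_dist_ub// ltW.
rewrite -scalerBr normrZ gtr0_norm// (minr_pMr _ _ (ltW lam0)) mulr1.
by rewrite le_min !ge_min lam1 lexx orbT.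
Qed.

(** The prepended entry is common to both images and contributes 0; the other differences are merely
    shifted, whence the Lipschitz constant 1. *)
Lemma shift_map_cmaps (u : E) : cmaps (linf E) (shift_map u).
Proof.
apply: (@lipschitz_cmaps _ 1) => // x y; rewrite mul1r.
apply: linf_dist_le => -[|j] /=; last exact: linf_dist_ub.
by rewrite subrr normr0 ge_min [X in _ || X](mdist_ge0 x y) orbT.
Qed.

Lemma Fmaps_cmaps (lam : R) (G : set E) : 1 <= lam ->
  Fmaps lam G `<=` cmaps (linf E).
Proof.
move=> lam1 f [[->|->]|[u _ <-]].
- exact: (cst_cmaps (Linf zero_bounded)).
- exact: scale_map_cmaps.
- exact: shift_map_cmaps.
Qed.

End UniformDistance.

(** * Words: length as compositions, coordinates, mutual distances *)

Lemma compositions_comp (T : Type) (F : set (T -> T)) (m : nat) (f g : T -> T) :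
  F g -> compositions m F f -> compositions m.+1 F (g \o f).
Proof.
move=> Fg [n [h [nm Fh ->]]].
(* Index 0 is the outermost factor, so it receives [g], and [unlift] shifts the factors of [f] by
   one. *)
exists n.+1, (fun i => if unlift ord0 i is Some j then h j else g).
split=> // [i|]; first by case: unliftP.
rewrite big_ord_recl unlift_none; congr (g \o _).
by apply: eq_bigr => i _; rewrite liftK.
Qed.

Section Words.
Context {R : realType} {E : normedModType R}.
Implicit Types (lam : R) (s : seq E) (x : linf E).

Let step lam := fun (f : linf E -> linf E) a =>
  scale_map lam \o shift_map a \o f.

(** By induction on the last letter, which is applied outermost: it lands in entry 0 and the older
    entries gain a factor [lam]. The default 0 of [nth] accounts for the zero tail. *)
Lemma foldl_word_coord lam s x (n : nat) :
  foldl (step lam) zero_map s x n = lam ^+ n.+1 *: nth 0 (rev s) n.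
Proof.
elim/last_ind: s n => [|s a IHs] [|n]; rewrite ?nth_nil ?scaler0//.
  by rewrite foldl_rcons rev_rcons /= expr1.
by rewrite foldl_rcons rev_rcons /= IHs scalerA -exprS.
Qed.

Lemma foldl_word_compositions lam (G : set E) s :
  (forall a, a \in s -> G a) ->
  compositions (2 * size s + 1) (Fmaps lam G) (foldl (step lam) zero_map s).
Proof.
elim/last_ind: s => [_|s a IHs sG].
  exists 1%N, (fun _ => zero_map); split=> // [_|]; first by left; left.
  by rewrite big_ord_recl big_ord0.
(* Each letter adds two factors, a shift and a scaling; the 1 in the bound is the initial
   [zero_map]. *)
rewrite foldl_rcons size_rcons mulnS !addSn.
apply: (@compositions_comp _ _ _ (shift_map a \o _)); first by left; right.
apply: compositions_comp; last first.
  by apply: IHs => b bs; apply: sG; rewrite mem_rcons inE bs orbT.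
by right; exists a => //; apply: sG; rewrite mem_rcons mem_head.
Qed.

Variables (lam : R) (k : nat).
Implicit Types u v : 'I_k -> E.

Lemma word_coord u x (i : 'I_k) :
  word lam u x i = lam ^+ i.+1 *: u (rev_ord i).
Proof.
rewrite /word foldl_word_coord nth_rev size_codom card_ord//; congr (_ *: _).
have ki := ltn_ord (rev_ord i).
by rewrite (nth_map i) ?size_enum_ord// -[X in nth _ _ X]/(val (rev_ord i)) nth_ord_enum.
Qed.

Lemma word_coord_ge u x (n : nat) : (k <= n)%N -> word lam u x n = 0.
Proof.
move=> kn; rewrite /word foldl_word_coord nth_default ?scaler0//.
by rewrite size_rev size_codom card_ord.
Qed.

Lemma word_cst u : exists c : linf E, word lam u = cst c.
Proof.
exists (word lam u (Linf zero_bounded)); apply/funext => x; apply: linf_eqP.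
by move=> n; rewrite /word !foldl_word_coord.
Qed.

Lemma words_compositions (G : set E) :
  words lam G k `<=` compositions (2 * k + 1) (Fmaps lam G).
Proof.
move=> _ [u uG <-].
have -> : (2 * k + 1 = 2 * size (codom u) + 1)%N by rewrite size_codom card_ord.
by apply: foldl_word_compositions => a /codomP[i ->]; exact: uG.
Qed.

(** The coordinates of a word do not depend on its argument, so one argument already realizes the
    supremum. *)
Lemma dinfty_word u v : 0 <= lam ->
  dinfty (word lam u) (word lam v) =
  \big[Num.max/0]_(i < k) Num.min 1 (lam ^+ (k - i) * `|u i - v i|).
Proof.
move=> lam0.
(* Entry [i] holds the letter [rev_ord i], and [i.+1 = k - rev_ord i] re-indexes the exponent by
   letters. *)
have termE x (i : 'I_k) : `|word lam u x i - word lam v x i| =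
    lam ^+ (k - rev_ord i) * `|u (rev_ord i) - v (rev_ord i)|.
  rewrite !word_coord -scalerBr normrZ ger0_norm ?exprn_ge0//.
  by rewrite /= subKn.
apply/eqP; rewrite eq_le; apply/andP; split.
  apply: dinfty_le => x; apply: linf_dist_le => n.
  case: (ltnP n k) => kn; last first.
    rewrite !word_coord_ge// subrr normr0 ge_min; apply/orP; right.
    exact: bigmax_ge_id.
  have -> : `|word lam u x n - word lam v x n| = _ := termE x (Ordinal kn).
  by apply: (bigmax_sup (rev_ord (Ordinal kn))).
pose z : linf E := Linf zero_bounded.
apply: bigmax_le => [|i _].
  by apply: le_trans (dinfty_ub _ _ z); exact: (@mdist_ge0 R (linf E)).
apply: le_trans (dinfty_ub _ _ z).
have := linf_dist_ub (word lam u z) (word lam v z) (rev_ord i).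
by rewrite termE rev_ordK.
Qed.

End Words.

(** * The product bounds for the covering number of the words *)

Section WordCovering.
Context {R : realType} {E : normedModType R}.
Variables (G : set E) (lam : R) (k : nat).
Hypotheses (cG : compact G) (lam0 : 0 < lam).

Lemma prod_packing_le_covering_words (eps : R) : 0 < eps < 1 / 2 ->
  (\prod_(i < k) packing_number norm_dist (2 * eps / lam ^+ (k - i)) G
     <= covering_number (cmaps (linf E)) dinfty eps (words lam G k))%E.
Proof.
move=> /andP[e0 e2].
(* Stated as a sigma type so that a maximal packing can be extracted for every coordinate at
   once. *)
have pk (i : 'I_k) : {n : nat & {p : 'I_n -> E |
    [/\ packing_number norm_dist (2 * eps / lam ^+ (k - i)) G = (n%:R)%:E,
      forall a, G (p a) &
      forall a b, a <> b -> 2 * eps / lam ^+ (k - i) <= norm_dist (p a) (p b)]}}.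
  have d0 : 0 < eps / lam ^+ (k - i) by rewrite divr_gt0 ?exprn_gt0.
  have /cid[m hm] := compact_covered_by _ _ cG d0.
  have ub n : has_packing norm_dist (2 * eps / lam ^+ (k - i)) G n -> (n <= m)%N.
    (* The radius is twice [eps / lam ^+ (k - i)], so a finite cover at that smaller radius bounds
       every packing. *)
    rewrite -mulrA => hn.
    exact: packing_le_covering norm_dist_sym norm_dist_triangle hn hm.
  have /cid2[n hn nE] := packing_number_attained _ _ _ _ ub.
  by have /cid[p [pG sep]] := has_packing_centers _ _ _ _ hn; exists n, p.
pose n i := tag (pk i); pose p i : 'I_(n i) -> E := sval (tagged (pk i)).
have pP (i : 'I_k) : [/\ packing_number norm_dist (2 * eps / lam ^+ (k - i)) G = ((n i)%:R)%:E,
    forall a, G (p i a) &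
    forall a b, a <> b -> 2 * eps / lam ^+ (k - i) <= norm_dist (p i a) (p i b)].
  exact: (svalP (tagged (pk i))).
under eq_bigr => i _ do have [-> _ _] := pP i.
rewrite prodEFin -natr_prod -card_dffun_ord.
apply: ge_covering_number => m /covered_by_centers[c [_ hc]].
rewrite lee_fin ler_nat -[m]card_ord.
(* One word per choice of packing points; two choices differing in coordinate [i] give words at
   distance at least [2 * eps]. *)
pose W (a : {dffun forall i : 'I_k, 'I_(n i)}) := word lam (fun i => p i (a i)).
apply: (@card_separated_le _ _ dinfty eps _ _ W c);
  [exact: dinfty_sym|exact: dinfty_triangle| |].
  move=> a b ab; rewrite (dinfty_word _ _ _ _ (ltW lam0)).
  have [i abi] : exists i, a i <> b i.
    by apply/existsNP => h; apply: ab; apply/ffunP.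
  have [_ _ /(_ _ _ abi)] := pP i.
  rewrite ler_pdivrMr ?exprn_gt0// [leRHS]mulrC => h.
  apply: (bigmax_sup i) => //.
  (* The truncation at 1 is harmless because [eps < 1 / 2]. *)
  rewrite le_min; apply/andP; split; last exact: h.
  by rewrite mulrC -ler_pdivlMr// ltW.
move=> a; apply: hc; exists (fun i => p i (a i)) => // i.
by have [_ + _] := pP i; exact.
Qed.

Lemma covering_words_le_prod_covering (eps : R) : 0 < eps ->
  (covering_number (cmaps (linf E)) dinfty eps (words lam G k)
     <= \prod_(i < k)
          covering_number setT norm_dist (eps / lam ^+ (k - i)) G)%E.
Proof.
move=> e0.
have cv (i : 'I_k) : {n : nat & {c : 'I_n -> E |
    covering_number setT norm_dist (eps / lam ^+ (k - i)) G = (n%:R)%:E /\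
    forall x, G x -> exists a, norm_dist (c a) x < eps / lam ^+ (k - i)}}.
  have d0 : 0 < eps / lam ^+ (k - i) by rewrite divr_gt0 ?exprn_gt0.
  have /cid[m hm] := compact_covered_by _ _ cG d0.
  have /cid2[n hn nE] := covering_number_attained _ _ _ _ _ hm.
  by have /cid[c [_ Gc]] := covered_by_centers _ _ _ _ _ hn; exists n, c.
pose n i := tag (cv i); pose c i : 'I_(n i) -> E := sval (tagged (cv i)).
have cP (i : 'I_k) : covering_number setT norm_dist (eps / lam ^+ (k - i)) G = ((n i)%:R)%:E /\
    forall x, G x -> exists a, norm_dist (c i a) x < eps / lam ^+ (k - i).
  exact: (svalP (tagged (cv i))).
under eq_bigr => i _ do rewrite (cP i).1.
rewrite prodEFin -natr_prod -card_dffun_ord.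
(* The centers are the words spelled with centers of minimal covers of [G]. These letters may lie
   outside [G], but the words are constant, hence continuous. *)
apply: (@covering_number_le_card _ _ _ _ _ _ _
  (fun a : {dffun forall i : 'I_k, 'I_(n i)} => word lam (fun i => c i (a i)))).
  by move=> a; have [w ->] := word_cst lam _ (fun i => c i (a i)); exact: cst_cmaps.
move=> _ [u uG <-].
have a (i : 'I_k) : {a : 'I_(n i) | norm_dist (c i a) (u i) < eps / lam ^+ (k - i)}.
  by apply: cid; exact: (cP i).2.
exists [ffun i => sval (a i)]; rewrite (dinfty_word _ _ _ _ (ltW lam0)).
(* The strict bound also has to hold for the initial value 0 of the maximum, which is [0 < eps]. *)
apply: bigmax_lt => // i _; rewrite ffunE gt_min; apply/orP; right.
by rewrite mulrC -ltr_pdivlMr ?exprn_gt0//; exact: (svalP (a i)).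
Qed.

End WordCovering.

(* The 1-based index j of the source is i + 1 for i : 'I_k. *)
Theorem mainTheorem9 (R : realType) (E : completeNormedModType R) (G : set E)
    (lam : R) (k : nat) (hG : compact G) (hlam : 1 < lam) (hk : (1 <= k)%N) :
  Fmaps lam G `<=` cmaps (linf E) /\
  words lam G k `<=` compositions (2 * k + 1) (Fmaps lam G) /\
  (forall u : 'I_k -> E, (forall j, G (u j)) ->
    (forall x : linf E,
      (forall i : 'I_k, word lam u x i = lam ^+ i.+1 *: u (rev_ord i)) /\
      (forall n : nat, (k <= n)%N -> word lam u x n = 0)) /\
    (exists c : linf E, word lam u = cst c)) /\
  (forall u v : 'I_k -> E, (forall j, G (u j)) -> (forall j, G (v j)) ->
    dinfty (word lam u) (word lam v) =
    \big[Num.max/0]_(i < k) Num.min 1 (lam ^+ (k - i) * `|u i - v i|)) /\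
  (forall eps : R, 0 < eps < 1 / 2 ->
    (\prod_(i < k) packing_number norm_dist (2 * eps / lam ^+ (k - i)) G
       <= covering_number (cmaps (linf E)) dinfty eps (words lam G k))%E /\
    (covering_number (cmaps (linf E)) dinfty eps (words lam G k)
       <= \prod_(i < k)
            covering_number setT norm_dist (eps / lam ^+ (k - i)) G)%E) /\
  (forall eps : R, 0 < eps ->
    (covering_number (cmaps (linf E)) dinfty eps (words lam G k)
       <= covering_number (cmaps (linf E)) dinfty eps
            (compositions (2 * k + 1) (Fmaps lam G)))%E).
Proof.
have lam0 := lt_trans ltr01 hlam.
split; first exact/Fmaps_cmaps/ltW.
split; first exact: words_compositions.
split.
  move=> u _; split=> [x|]; last exact: word_cst.
  by split=> [i|n]; [exact: word_coord|exact: word_coord_ge].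
split; first by move=> u v _ _; exact/dinfty_word/ltW.
split=> eps e0; last exact/le_covering_number/words_compositions.
split; first exact: prod_packing_le_covering_words.
by apply: covering_words_le_prod_covering => //; case/andP: e0.
Qed.
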